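(* Let $R_3$ and $R_4$ be the regular rooted trees of degree $3$ and $4$ respectively. Then, as abstract groups, $\mathrm{Aut}(R_3)$ is isomorphic to a subgroup of $\mathrm{Aut}(R_4)$ and $\mathrm{Aut}(R_4)$ is isomorphic to a subgroup of $\mathrm{Aut}(R_3)$.
   Context: For $d\ge 2$, $R_d$ is the rooted tree whose root vertex has degree $d$ and in which every other vertex has degree $d+1$. $\mathrm{Aut}(R_d)$ is the group of simplicial automorphisms of $R_d$ (all of which fix the root). *)

(* Defs.v *)
From HB Require Import structures.
From mathcomp Require Import all_boot.
From mathcomp Require Import boolp.
Set Implicit Arguments.
Unset Strict Implicit.
Unset Printing Implicit Defensive.

Record simple_graph := SimpleGraph {
  vertex :> eqType;
  adj : rel vertex;
  adj_sym : symmetric adj;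
  adj_irr : irreflexive adj }.
Arguments adj {s}.

Definition connected (G : simple_graph) :=
  forall x y : G, exists p : seq G, path adj x p /\ last x p = y.

(* In a simple graph the [ucycle]s of size 0 and 1 are degenerate and those of
   size 2 traverse an edge back and forth; genuine cycles have size >= 3. *)
Definition acyclic (G : simple_graph) :=
  forall c : seq G, ucycle adj c -> size c <= 2.

Definition has_degree (G : simple_graph) (x : G) (n : nat) :=
  exists s : seq G, [/\ uniq s, size s = n & forall y, (y \in s) = adj x y].

Record rooted_tree := RootedTree {
  tree_graph :> simple_graph;
  tree_root : tree_graph;
  tree_connected : connected tree_graph;
  tree_acyclic : acyclic tree_graph }.

(* "T is R_d".  Rooted trees satisfying this are unique up to isomorphism; one
   exists by [regular_rooted_exists] below. *)
Definition regular_rooted (d : nat) (T : rooted_tree) :=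
  has_degree (tree_root T) d /\
  forall x : T, x != tree_root T -> has_degree x d.+1.

(* The inverse is stored as data; since it is determined by [aut_fun], two
   automorphisms are equal as soon as their functions agree ([graph_aut_eq]).
   The root is not required to be fixed. *)
Record graph_aut (G : simple_graph) := GraphAut {
  aut_fun :> G -> G;
  aut_inv : G -> G;
  aut_funK : cancel aut_fun aut_inv;
  aut_invK : cancel aut_inv aut_fun;
  aut_adj : {mono aut_fun : x y / adj x y} }.

Section AutGroup.
Variable G : simple_graph.
Implicit Types f g h : graph_aut G.

Lemma graph_aut_eq f g : f =1 g -> f = g.
Proof.
case: f g => f f' fK f'K fa [g g' gK g'K ga] /= /funext fg.
move: fK f'K fa; rewrite {}fg => fK f'K fa.
have fg' : f' = g' by apply: funext => x; rewrite -{1}(g'K x) fK.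
move: fK f'K; rewrite {}fg' => fK f'K.
by congr GraphAut; apply: Prop_irrelevance.
Qed.

Definition aut_one : graph_aut G :=
  @GraphAut G id id (fun=> erefl) (fun=> erefl) (fun _ _ => erefl).

Definition aut_comp f g : graph_aut G :=
  @GraphAut G (f \o g) (aut_inv g \o aut_inv f)
    (can_comp (aut_funK f) (aut_funK g)) (can_comp (aut_invK g) (aut_invK f))
    (fun x y => etrans (aut_adj f _ _) (aut_adj g x y)).

Lemma aut_inv_adj f : {mono aut_inv f : x y / adj x y}.
Proof. by move=> x y; rewrite -(aut_adj f) !aut_invK. Qed.

Definition aut_inverse f : graph_aut G :=
  GraphAut (aut_invK f) (aut_funK f) (aut_inv_adj f).

HB.instance Definition _ := gen_eqMixin (graph_aut G).
HB.instance Definition _ := gen_choiceMixin (graph_aut G).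

Lemma aut_compA : associative aut_comp.
Proof. by move=> f g h; apply: graph_aut_eq. Qed.
Lemma aut_comp1 : left_id aut_one aut_comp.
Proof. by move=> f; apply: graph_aut_eq. Qed.
Lemma aut_compf1 : right_id aut_one aut_comp.
Proof. by move=> f; apply: graph_aut_eq. Qed.
Lemma aut_compV : left_inverse aut_one aut_inverse aut_comp.
Proof. by move=> f; apply: graph_aut_eq => x /=; rewrite aut_funK. Qed.
Lemma aut_compfV : right_inverse aut_one aut_inverse aut_comp.
Proof. by move=> f; apply: graph_aut_eq => x /=; rewrite aut_invK. Qed.

HB.instance Definition _ := isGroup.Build (graph_aut G)
  aut_compA aut_comp1 aut_compf1 aut_compV aut_compfV.

End AutGroup.

Definition Aut (T : rooted_tree) : groupType := graph_aut T.

Definition isomorphic_to_subgroup (G H : groupType) :=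
  exists K : {pred H}, group_closed K /\
  exists f : {multiplicative G -> H},
    injective f /\ forall y : H, y \in K <-> exists x : G, f x = y.

Section WordTree.
Variable d : nat.

Definition word_adj : rel (seq 'I_d) := fun u v =>
  (u != [::]) && (behead u == v) || (v != [::]) && (behead v == u).

Lemma word_adj_sym : symmetric word_adj.
Proof. by move=> u v; rewrite /word_adj orbC. Qed.

Lemma word_adj_irr : irreflexive word_adj.
Proof.
case=> [|i u] //; rewrite /word_adj orbb /=.
by apply/eqP => /(congr1 size) /n_Sn.
Qed.

Definition word_graph := SimpleGraph word_adj_sym word_adj_irr.

Lemma word_connected : connected word_graph.
Proof.
have down (u : seq 'I_d) :
    exists p, path word_adj u p /\ last u p = [::].
  elim: u => [|i u [p [up lp]]]; first by exists [::].
  by exists (u :: p); rewrite /= up /word_adj /= eqxx.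
have up (u : seq 'I_d) :
    exists p, path word_adj [::] p /\ last [::] p = u.
  elim: u => [|i u [p [pu lp]]]; first by exists [::].
  exists (rcons p (i :: u)); rewrite rcons_path last_rcons pu lp.
  by rewrite /word_adj /= eqxx orbT.
move=> x y; have [p [xp lp]] := down x; have [q [pq lq]] := up y.
by exists (p ++ q); rewrite cat_path last_cat xp lp.
Qed.

Lemma word_acyclic : acyclic word_graph.
Proof.
move=> c /andP[cc uc]; case: c cc uc => [|x0 c0] //; set c := x0 :: c0 => cc uc.
have [x xc xmax] : exists2 x, x \in c & {in c, forall y, size y <= size x}.
  exists (nth x0 c [arg max_(i > @ord0 (size c0)) size (nth x0 c i)]).
    exact: mem_nth.
  by case: arg_maxnP => // i _ im y /(nthP x0)[j jc <-]; apply: (im (Ordinal jc)).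
have par y : y \in c -> word_adj x y -> y = behead x.
  move=> yc; case/orP=> /andP[y0 /eqP yx] //.
  by move: (xmax _ yc); rewrite -yx size_behead; case: (y) y0 => //= ? ?; rewrite ltnn.
have nx : next c x = behead x.
  by apply: par; [rewrite mem_next | exact: next_cycle cc xc].
have px : prev c x = behead x.
  apply: par; first by rewrite mem_prev.
  by rewrite word_adj_sym; exact: prev_cycle cc xc.
have nnx : next c (next c x) = x by rewrite nx -px next_prev.
have [i t ct] := rot_to xc.
have ut : uniq (x :: t) by rewrite -ct rot_uniq.
have : next (x :: t) (next (x :: t) x) = x.
  by rewrite -ct !next_rot.
rewrite -(size_rot i) ct; case: t ut {ct} => [|y [|z t]] //=.
rewrite !inE !negb_or eqxx => /and3P[/and3P[xy xz _] _ _].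
by rewrite (eq_sym y) (negPf xy) eqxx => zx; rewrite zx eqxx in xz.
Qed.

Definition word_tree := @RootedTree word_graph [::] word_connected word_acyclic.

Lemma regular_rooted_exists : exists T, regular_rooted d T.
Proof.
exists word_tree.
have uc (u : seq 'I_d) : uniq [seq i :: u | i <- enum 'I_d].
  by rewrite map_inj_uniq ?enum_uniq // => i j [].
have mc (u v : seq 'I_d) :
    (v \in [seq i :: u | i <- enum 'I_d]) = (v != [::]) && (behead v == u).
  apply/mapP/andP => [[i _ ->]|[]]; first by rewrite /= eqxx.
  by case: v => // i v _ /eqP <-; exists i; rewrite ?mem_enum.
split=> [|x x0].
  exists [seq [:: i] | i <- enum 'I_d]; rewrite uc size_map size_enum_ord.
  by split=> // y; rewrite mc.
exists (behead x :: [seq i :: x | i <- enum 'I_d]).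
rewrite /= uc size_map size_enum_ord andbT; split=> // [|y].
  rewrite mc negb_and; apply/orP; right; apply/eqP => /(congr1 size).
  case: x x0 => //= i x _; rewrite size_behead => h.
  by move: (leq_pred (size x)); rewrite h ltnn.
by rewrite inE mc /word_adj x0 eq_sym.
Qed.

End WordTree.

(* Main.v *)
Require Import Defs.
From HB Require Import structures.
From mathcomp Require Import all_boot.
From mathcomp Require Import boolp.
Set Implicit Arguments.
Unset Strict Implicit.
Unset Printing Implicit Defensive.

(* Words over {0, ..., d-1} label R_d.  Let a group act on a set of nodes, with
   a finite child list of size at most d attached equivariantly to each node; if
   the action fixes the root node and is faithful on the descendants of the
   root, unfolding the nodes into words and letting it move surplus branches
   rigidly embeds the group in Aut(R_d).  For R_3 in R_4 the nodes are the
   vertices of R_3.  For R_4 in R_3, S_4 permutes the three partitions of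
   {0, 1, 2, 3} into two pairs, a partition has two blocks and a block two
   elements; so between a vertex of R_4 and its four children one can insert an
   Aut(R_4)-equivariant refinement of branching 3, 2, 2 in which every child is
   reached (three times over). *)

(** * Injective homomorphisms and transport along graph isomorphisms *)

Definition embeds (G H : groupType) :=
  exists2 f : G -> H, {morph f : x y / (x * y)%g} & injective f.

Lemma embeds_trans (G H K : groupType) : embeds G H -> embeds H K -> embeds G K.
Proof.
move=> [f fM f_inj] [h hM h_inj]; exists (h \o f) => [x y|]; last exact: inj_comp.
by rewrite /= fM hM.
Qed.

(** The subgroup is the image of [f], turned into a boolean predicate classically. *)
Lemma embeds_isomorphic (G H : groupType) : embeds G H -> isomorphic_to_subgroup G H.
Proof.
case=> f fM f_inj.
have fF : {morph f : x y / (x / y)%g}.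
  by move=> x y; rewrite -[x in RHS](divgK y) [in RHS]fM mulgK.
exists (fun y => `[< exists x, f x = y >]); split; last first.
  exists (HB.pack f (isMultiplicative.Build G H f fM) : {multiplicative G -> H}).
  split=> // y; rewrite unfold_in.
  by split=> [/asboolP|?] //; apply/asboolP.
split=> [|x y]; rewrite !unfold_in.
  by apply/asboolP; exists (1 / 1)%g; rewrite fF divgg.
move=> /asboolP[a <-] /asboolP[b <-]; apply/asboolP.
by exists (a / b)%g; rewrite fF.
Qed.

Lemma graph_aut_conj (G H : simple_graph) (phi : G -> H) (psi : H -> G) :
    cancel phi psi -> cancel psi phi -> {mono phi : x y / adj x y} ->
  exists c : graph_aut G -> graph_aut H, forall g x, c g x = phi (g (psi x)).
Proof.
move=> phiK psiK phi_adj.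
have conjK (g h : G -> G) :
    cancel g h -> cancel (phi \o g \o psi) (phi \o h \o psi).
  by move=> gK x /=; rewrite phiK gK psiK.
have conj_adj (g : graph_aut G) : {mono phi \o g \o psi : x y / adj x y}.
  by move=> x y /=; rewrite phi_adj aut_adj -phi_adj !psiK.
by exists (fun g => GraphAut (conjK _ _ (aut_funK g)) (conjK _ _ (aut_invK g))
                             (conj_adj g)).
Qed.

Lemma graph_iso_embeds (G H : simple_graph) (phi : G -> H) (psi : H -> G) :
    cancel phi psi -> cancel psi phi -> {mono phi : x y / adj x y} ->
  embeds (graph_aut G) (graph_aut H).
Proof.
move=> phiK psiK phi_adj; have [c cE] := graph_aut_conj phiK psiK phi_adj.
exists c => [g h|g h gh]; apply: graph_aut_eq => x.
  by rewrite /= !cE phiK.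
by apply: (can_inj phiK); rewrite -(phiK x) -!cE gh.
Qed.

(** * Degrees and the fixed root *)

Lemma has_degree_inj (G : simple_graph) (x : G) (m n : nat) :
  has_degree x m -> has_degree x n -> m = n.
Proof.
case=> s [us <- sP] [t [ut <- tP]].
by apply/perm_size/uniq_perm => // y; rewrite sP tP.
Qed.

Lemma has_degree_aut (G : simple_graph) (g : graph_aut G) (x : G) (n : nat) :
  has_degree x n -> has_degree (g x) n.
Proof.
case=> s [us sn sP]; exists (map g s); split; first 2 last.
- move=> y; rewrite -[y in RHS](aut_invK g) aut_adj -sP -{1}(aut_invK g y).
  exact/mem_map/can_inj/aut_funK.
- by rewrite map_inj_uniq //; exact/can_inj/aut_funK.
- by rewrite size_map.
Qed.

(** Automorphisms preserve degrees, and only the root has degree [d]. *)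
Lemma regular_aut_root (d : nat) (T : rooted_tree) (g : graph_aut T) :
  regular_rooted d T -> g (tree_root T) = tree_root T.
Proof.
case=> root_deg deg; apply/eqP/negPn/negP => /deg gdeg.
by have /n_Sn := has_degree_inj (has_degree_aut g root_deg) gdeg.
Qed.

(** * Non-backtracking walks in acyclic graphs *)

Section NonBacktracking.
Variable T : eqType.

Fixpoint non_backtracking (s : seq T) : bool :=
  if s is x :: ((_ :: z :: _) as t) then (x != z) && non_backtracking t else true.

Lemma non_backtracking_cons (x : T) (s : seq T) :
  non_backtracking (x :: s) -> non_backtracking s.
Proof. by case: s => [|y [|z s]] //= /andP[]. Qed.

Lemma uniq_non_backtracking (s : seq T) : uniq s -> non_backtracking s.
Proof.
elim: s => [|x s IHs] //= /andP[xs /IHs]; case: s xs {IHs} => [|y [|z s]] //.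
by rewrite !inE !negb_or => /and3P[_ -> _].
Qed.

End NonBacktracking.

(** By induction the tail of the walk is simple, so a return to [x] would close a cycle. Acyclicity
    bounds its size by 2; size 1 would be a loop and size 2 a backtrack. *)
Lemma acyclic_non_backtracking_uniq (G : simple_graph) (x : G) (p : seq G) :
  acyclic G -> path adj x p -> non_backtracking (x :: p) -> uniq (x :: p).
Proof.
move=> acyc; elim: p x => [|y p IHp] x // xyp nb.
have /andP[xy yp] : adj x y && path adj y p by [].
have uyp := IHp y yp (non_backtracking_cons nb).
rewrite cons_uniq uyp andbT; apply/negP => xin.
case/splitPr: xin xyp nb uyp => p1 p2.
rewrite cat_path -cat_rcons cat_uniq rcons_uniq.
move=> /= /and3P[xp1 px _] nb /and3P[/andP[xNp1 up1] _ _].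
have /acyc : ucycle adj (x :: p1).
  by rewrite /ucycle /= rcons_path xp1 px xNp1.
case: p1 xp1 px nb {xNp1 up1} => [|a [|b p1]] //=; first by rewrite adj_irr.
by rewrite eqxx.
Qed.

(** * Labelling the vertices of a regular rooted tree by words *)

Section Labelling.
Variables (d : nat) (T : rooted_tree) (nbrs : T -> seq T).
Hypothesis nbrs_uniq : forall x, uniq (nbrs x).
Hypothesis mem_nbrs : forall x y, (y \in nbrs x) = adj x y.
Hypothesis size_nbrs : forall x, size (nbrs x) = d + (x != tree_root T).

(** The head of a word is the last step down from the root, so [behead] gives the parent. Vertex and
    child list are computed together because the child list is the neighbour list without the
    parent. The default of [nth] is never reached: child lists have size [d]. *)
Fixpoint word_vertex_children (w : seq 'I_d) : T * seq T :=
  if w is i :: u then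
    let: (x, c) := word_vertex_children u in
    let y := nth x c i in (y, rem x (nbrs y))
  else (tree_root T, nbrs (tree_root T)).

Definition word_vertex (w : seq 'I_d) : T := (word_vertex_children w).1.
Definition word_children (w : seq 'I_d) : seq T := (word_vertex_children w).2.

Lemma word_vertex_cons i u :
  word_vertex (i :: u) = nth (word_vertex u) (word_children u) i.
Proof. by rewrite /word_vertex /word_children /=; case: word_vertex_children. Qed.

Lemma word_children_cons i u :
  word_children (i :: u) = rem (word_vertex u) (nbrs (word_vertex (i :: u))).
Proof. by rewrite /word_children /word_vertex /=; case: word_vertex_children. Qed.

Lemma mem_word_children w y : y \in word_children w =
  (adj (word_vertex w) y) && ((w == [::]) || (y != word_vertex (behead w))).
Proof.
case: w => [|i u]; first by rewrite andbT -mem_nbrs.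
by rewrite word_children_cons mem_rem_uniq // inE mem_nbrs andbC.
Qed.

Lemma word_children_uniq w : uniq (word_children w).
Proof.
by case: w => [|i u]; [exact: nbrs_uniq | rewrite word_children_cons rem_uniq].
Qed.

(** The walk from [word_vertex w] up to the root, without its starting vertex. *)
Fixpoint word_trail (w : seq 'I_d) : seq T :=
  if w is i :: u then word_vertex u :: word_trail u else [::].

Lemma last_word_trail w x : last x (word_trail w) = if w is [::] then x else tree_root T.
Proof. by elim: w x => [|i [|j u] IHu] x //=; exact: IHu. Qed.

(** The three claims need each other: child lists of size [d] keep [nth] in range, which makes the
    trail a non-backtracking walk, which in turn shows that a proper descent never meets the root
    again, so that [d] neighbours remain besides the parent. *)
Lemma word_trailP w :
  [/\ path adj (word_vertex w) (word_trail w),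
      non_backtracking (word_vertex w :: word_trail w)
    & size (word_children w) = d].
Proof.
elim: w => [|i u [up unb usz]].
  by split=> //; rewrite /word_children /= size_nbrs eqxx addn0.
have : word_vertex (i :: u) \in word_children u.
  by rewrite word_vertex_cons mem_nth ?usz.
rewrite mem_word_children => /andP[ui uNi].
have iup : path adj (word_vertex (i :: u)) (word_trail (i :: u)).
  by rewrite /= adj_sym ui.
have iunb : non_backtracking (word_vertex (i :: u) :: word_trail (i :: u)).
  by case: (u) uNi unb => [|j v] //= uNi unb; apply/andP; split.
split=> //; rewrite word_children_cons size_rem ?mem_nbrs 1?adj_sym //.
(* The trail is simple and ends at the root, so it cannot also start there. *)
have := acyclic_non_backtracking_uniq (@tree_acyclic T) iup iunb.
rewrite size_nbrs; case: eqP => [->|]; last by rewrite addn1.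
have /= <- := last_word_trail (i :: u) (tree_root T).
by rewrite /= mem_last.
Qed.

Lemma size_word_children w : size (word_children w) = d.
Proof. by case: (word_trailP w). Qed.

Lemma word_vertex_child i u : word_vertex (i :: u) \in word_children u.
Proof. by rewrite word_vertex_cons mem_nth ?size_word_children. Qed.

Lemma adj_word_vertex_cons i u : adj (word_vertex u) (word_vertex (i :: u)).
Proof. by have := word_vertex_child i u; rewrite mem_word_children => /andP[]. Qed.

Lemma word_vertex_grandparent i u :
  u != [::] -> word_vertex (i :: u) != word_vertex (behead u).
Proof.
by have := word_vertex_child i u; rewrite mem_word_children => /andP[_ /orP[->|]].
Qed.

Lemma adj_word_vertex u v : word_adj u v -> adj (word_vertex u) (word_vertex v).
Proof.
rewrite /word_adj => /orP[] /andP[]; last first.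
  by case: v => // i v _ /eqP <-; exact: adj_word_vertex_cons.
by case: u => // i u _ /eqP <-; rewrite adj_sym; exact: adj_word_vertex_cons.
Qed.

(** Child lists have no duplicates and leave out the parent. *)
Lemma word_vertex_locally_inj u v w :
  word_adj u v -> word_adj u w -> word_vertex v = word_vertex w -> v = w.
Proof.
rewrite /word_adj => /orP[] /andP[] + /eqP + /orP[] /andP[] + /eqP; first by move=> _ <- _ <-.
- case: w => // i w u0 <- _ /= -> /eqP.
  by rewrite eq_sym (negPf (word_vertex_grandparent _ u0)).
- case: v => // i v _ /= -> u0 <- /eqP.
  by rewrite (negPf (word_vertex_grandparent _ u0)).
case: v w => // i v [|j w] // _ /= <- _ /= ->.
move=> /eqP; rewrite !word_vertex_cons nth_uniq ?size_word_children ?word_children_uniq //.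
by move=> /eqP/val_inj ->.
Qed.

(* A geodesic of the word tree is mapped to a non-backtracking walk. *)
Lemma word_vertex_inj : injective word_vertex.
Proof.
move=> u v; apply: contra_eq => uv.
have [p [pP pv]] := word_connected u v.
case/shortenP: pP pv => q qP qU _ qv.
have walk : path adj (word_vertex u) (map word_vertex q) /\
    non_backtracking (word_vertex u :: map word_vertex q).
  elim: q u qP qU {uv qv p} => [|w q IHq] u //= /andP[uw wq] /andP[uNq wqU].
  have [-> nb] := IHq w wq wqU; split; first by rewrite adj_word_vertex.
  case: q wq uNq {IHq wqU} nb => [|x q] //= /andP[wx _] uNq ->; rewrite andbT.
  apply/eqP => /(word_vertex_locally_inj _ wx); rewrite word_adj_sym => /(_ uw) ux.
  by rewrite ux !inE eqxx orbT in uNq.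
have /= := acyclic_non_backtracking_uniq (@tree_acyclic T) walk.1 walk.2.
case: q qv {qP qU walk} => [/= uv'|w q <- /andP[+ _]]; first by rewrite uv' eqxx in uv.
by apply: contraNneq => ->; rewrite map_f //= mem_last.
Qed.

(** Lifting of edges: with connectedness it gives surjectivity, with injectivity it shows that
    adjacency is reflected. *)
Lemma word_vertex_nbr u y : adj (word_vertex u) y ->
  exists2 v, word_adj u v & word_vertex v = y.
Proof.
move=> uy; have [yc|] := boolP (y \in word_children u).
  have yd : index y (word_children u) < d by rewrite -(size_word_children u) index_mem.
  exists (Ordinal yd :: u); first by rewrite /word_adj /= eqxx orbT.
  by rewrite word_vertex_cons nth_index.
rewrite mem_word_children uy /= negb_or negbK => /andP[u0 /eqP ->].
by exists (behead u); rewrite // /word_adj u0 eqxx.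
Qed.

Lemma word_vertex_surj y : exists w, word_vertex w = y.
Proof.
have [p []] := tree_connected (tree_root T) y.
have : exists w, word_vertex w = tree_root T by exists [::].
elim: p (tree_root T) => [|z p IHp] x xw /= => [_ <- //|/andP[xz zp] py].
case: xw xz => w <- /word_vertex_nbr[v _ vz].
by apply: (IHp z) => //; exists v.
Qed.

Lemma word_vertex_adj : {mono word_vertex : u v / word_adj u v >-> adj u v}.
Proof.
move=> u v; apply/idP/idP; last exact: adj_word_vertex.
by move/word_vertex_nbr => [w uw /word_vertex_inj <-].
Qed.

End Labelling.

Lemma regular_rooted_labelling (d : nat) (T : rooted_tree) : regular_rooted d T ->
  exists (phi : word_graph d -> T) (psi : T -> word_graph d),
    [/\ cancel phi psi, cancel psi phi, {mono phi : u v / adj u v}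
      & phi [::] = tree_root T].
Proof.
case=> root_deg deg.
have /choice[nbrs nbrsP] (x : T) : exists s : seq T,
    [/\ uniq s, size s = d + (x != tree_root T) & forall y, (y \in s) = adj x y].
  case: (eqVneq x (tree_root T)) => [->|/deg]; first by rewrite addn0.
  by rewrite addn1.
have nU x : uniq (nbrs x) by case: (nbrsP x).
have nA x y : (y \in nbrs x) = adj x y by case: (nbrsP x).
have nS x : size (nbrs x) = d + (x != tree_root T) by case: (nbrsP x).
have /choice[psi psiK] := word_vertex_surj nU nA nS.
exists (word_vertex nbrs), psi; split=> //; last exact: word_vertex_adj.
by move=> w; apply: (word_vertex_inj nU nA nS).
Qed.

(** * Automorphisms of the word tree and their local permutations *)

Lemma word_aut_nil (d : nat) (g : graph_aut (word_graph d)) : g [::] = [::].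
Proof.
(* The existence statement hides its witness, so [g] is conjugated to an automorphism of some
   regular tree [T], whose root is fixed. *)
have [T Tr] := regular_rooted_exists d.
have [phi [psi [phiK psiK phi_adj phi0]]] := regular_rooted_labelling Tr.
have [c cE] := graph_aut_conj phiK psiK phi_adj.
by have := regular_aut_root (c g) Tr; rewrite cE -phi0 phiK => /(can_inj phiK).
Qed.

Lemma word_aut_behead (d : nat) (g : graph_aut (word_graph d)) (u : seq 'I_d) :
  behead (g u) = g (behead u).
Proof.
elim: u => [|i u IHu]; first by rewrite word_aut_nil.
have : word_adj (i :: u) u by rewrite /word_adj eqxx.
rewrite -(aut_adj g : {mono g : x y / word_adj x y}) => /orP[] /andP[_ /eqP] // .
(* In the other orientation [g (i :: u)] is the parent of [g u], so by induction [i :: u] equals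
   [behead u], which is too short. *)
rewrite IHu => /(can_inj (aut_funK g)) /(congr1 size) /=.
by rewrite size_behead => h; have := leq_pred (size u); rewrite h ltnn.
Qed.

Lemma word_aut_size (d : nat) (g : graph_aut (word_graph d)) (u : seq 'I_d) :
  size (g u) = size u.
Proof.
elim: u => [|i u IHu]; first by rewrite word_aut_nil.
have := word_aut_behead g (i :: u); case E : (g (i :: u)) => [|j v] /= vu.
  by have := congr1 (aut_inv g) E; rewrite aut_funK -[in RHS](word_aut_nil g) aut_funK.
by rewrite vu IHu.
Qed.

Definition word_aut_label (d : nat) (g : graph_aut (word_graph d))
  (u : seq 'I_d) (i : 'I_d) : 'I_d := head i (g (i :: u)).

Lemma word_aut_cons (d : nat) (g : graph_aut (word_graph d)) (u : seq 'I_d) i :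
  g (i :: u) = word_aut_label g u i :: g u.
Proof.
have := word_aut_size g (i :: u); have := word_aut_behead g (i :: u).
by rewrite /word_aut_label; case: (g (i :: u)) => //= j v ->.
Qed.

Lemma word_aut_label_inj (d : nat) (g : graph_aut (word_graph d)) (u : seq 'I_d) :
  injective (word_aut_label g u).
Proof.
move=> i j ij; suff /(can_inj (aut_funK g)) [] : g (i :: u) = g (j :: u) by [].
by rewrite !word_aut_cons ij.
Qed.

Lemma word_aut_label1 (d : nat) (u : seq 'I_d) :
  word_aut_label (1%g : graph_aut (word_graph d)) u = id.
Proof. exact: funext. Qed.

(** The cocycle rule for local permutations. *)
Lemma word_aut_labelM (d : nat) (g h : graph_aut (word_graph d)) (u : seq 'I_d) :
  word_aut_label (g * h)%g u = word_aut_label g (h u) \o word_aut_label h u.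
Proof.
apply: funext => i; have : (g * h)%g (i :: u) = g (h (i :: u)) by [].
by rewrite !word_aut_cons => -[].
Qed.

(** * Unfolding a group action into the word tree *)

Section UnfoldedAction.
Variables (d : nat) (G : groupType) (V : eqType).
Variables (act : G -> V -> V) (children : V -> seq V) (v0 : V).

Inductive descendant : V -> Prop :=
| descendant_root : descendant v0
| descendant_child v w : descendant v -> w \in children v -> descendant w.

Hypothesis act1 : forall v, act 1%g v = v.
Hypothesis actM : forall g h v, act (g * h)%g v = act g (act h v).
Hypothesis children_uniq : forall v, uniq (children v).
Hypothesis size_children : forall v, size (children v) <= d.
Hypothesis mem_children_act :
  forall g v x, x \in children v -> act g x \in children (act g v).
Hypothesis act_root : forall g, act g v0 = v0.
Hypothesis act_faithful :
  forall g h, (forall v, descendant v -> act g v = act h v) -> g = h.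

(* [None] marks the subtrees hanging below surplus labels; they are moved
   rigidly. *)
Fixpoint word_state (w : seq 'I_d) : option V :=
  if w is i :: u then obind (fun v => onth (children v) i) (word_state u)
  else Some v0.

(** The child at position [i] moves to its image's position in the child list of [act g v]; surplus
    labels stay. The default of [insubd] is never reached, as child lists have size at most [d]. *)
Definition state_label (g : G) (q : option V) (i : 'I_d) : 'I_d :=
  if q is Some v then
    if onth (children v) i is Some x then insubd i (index (act g x) (children (act g v)))
    else i
  else i.

Fixpoint word_act (g : G) (w : seq 'I_d) : seq 'I_d :=
  if w is i :: u then state_label g (word_state u) i :: word_act g u else [::].

Lemma act_inj g : injective (act g).
Proof. by apply: (can_inj (g := act g^-1%g)) => v; rewrite -actM mulVg act1. Qed.

(** [act g] injects one child list into the other, and the inverse of [g] injects back. Hence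
    surplus labels remain surplus. *)
Lemma size_children_act g v : size (children (act g v)) = size (children v).
Proof.
have le h u : size (children u) <= size (children (act h u)).
  rewrite -(size_map (act h)); apply: uniq_leq_size => [|_ /mapP[x xu ->]].
    by rewrite map_inj_uniq //; exact: act_inj.
  exact: mem_children_act.
apply/eqP; rewrite eqn_leq le andbT.
by have := le g^-1%g (act g v); rewrite -actM mulVg act1.
Qed.

Lemma val_state_label g v x (i : 'I_d) : onth (children v) i = Some x ->
  state_label g (Some v) i = index (act g x) (children (act g v)) :> nat.
Proof.
move=> ix; rewrite /state_label ix val_insubd (leq_trans _ (size_children (act g v))) //.
by rewrite index_mem mem_children_act //; apply/onthP; exists i.
Qed.

(** One step of equivariance; at a surplus label both sides are [None] because the two child lists
    have equal length. *)
Lemma onth_state_label g v (i : 'I_d) :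
  onth (children (act g v)) (state_label g (Some v) i) = omap (act g) (onth (children v) i).
Proof.
case E : (onth (children v) i) => [x|] /=.
  rewrite (val_state_label _ E) onthE (nth_map (act g x)).
    by rewrite nth_index // mem_children_act //; apply/onthP; exists i.
  by rewrite index_mem mem_children_act //; apply/onthP; exists i.
by rewrite E onth_default // size_children_act -onthNE E.
Qed.

Lemma state_label1 q i : state_label 1%g q i = i.
Proof.
case: q => // v; case E : (onth (children v) i) => [x|]; last by rewrite /state_label E.
apply/val_inj; rewrite /= (val_state_label _ E) !act1 -(onth_nth x _ _ _ E) index_uniq //.
by rewrite -onthTE E.
Qed.

Lemma state_labelM g h q i :
  state_label (g * h)%g q i = state_label g (omap (act h) q) (state_label h q i).
Proof.
case: q => // v; have := onth_state_label h v i.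
case E : (onth (children v) i) => [x|] Eh.
  by apply/val_inj; rewrite /= (val_state_label _ E) (val_state_label _ Eh) !actM.
have hi : state_label h (Some v) i = i by rewrite /state_label E.
by rewrite hi in Eh *; rewrite /state_label E /= Eh.
Qed.

Lemma word_state_act g w : word_state (word_act g w) = omap (act g) (word_state w).
Proof.
elim: w => [|i u IHu] /=; first by rewrite act_root.
rewrite IHu; case: (word_state u) => [v|] //=; exact: onth_state_label.
Qed.

Lemma word_act1 w : word_act 1%g w = w.
Proof. by elim: w => //= i u ->; rewrite state_label1. Qed.

Lemma word_actM g h w : word_act (g * h)%g w = word_act g (word_act h w).
Proof. by elim: w => //= i u ->; rewrite state_labelM word_state_act. Qed.

Lemma word_actK g : cancel (word_act g) (word_act g^-1%g).
Proof. by move=> w; rewrite -word_actM mulVg word_act1. Qed.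

Lemma word_actVK g : cancel (word_act g^-1%g) (word_act g).
Proof. by move=> w; rewrite -word_actM mulgV word_act1. Qed.

Lemma word_act_adj g : {mono word_act g : u v / word_adj u v}.
Proof.
have nil_act u : (word_act g u == [::]) = (u == [::]) by case: u.
have behead_act u : behead (word_act g u) = word_act g (behead u) by case: u.
by move=> u v; rewrite /word_adj !nil_act !behead_act !(can_eq (word_actK g)).
Qed.

Lemma descendant_word_state v : descendant v -> exists w, word_state w = Some v.
Proof.
elim=> [|{}v x _ [w wv] xv]; first by exists [::].
have xd : index x (children v) < d by rewrite (leq_trans _ (size_children v)) ?index_mem.
exists (Ordinal xd :: w); rewrite /= wv /= onthE (nth_map x) ?index_mem //.
by rewrite nth_index.
Qed.

Lemma unfolded_action_embeds : embeds G (graph_aut (word_graph d)).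
Proof.
pose F g : graph_aut (word_graph d) :=
  @GraphAut (word_graph d) _ _ (word_actK g) (word_actVK g) (word_act_adj g).
exists F => [g h|g h gh].
  by apply: graph_aut_eq; exact: word_actM.
apply: act_faithful => v /descendant_word_state[w wv].
(* The state of the moved word recovers the action on [v]. *)
have := congr1 (fun f : graph_aut (word_graph d) => word_state (f w)) gh.
by rewrite /= !word_state_act wv => -[].
Qed.

End UnfoldedAction.

(** * Embedding into a word tree of larger degree *)

Lemma word_aut_embeds_leq (m n : nat) : m <= n ->
  embeds (graph_aut (word_graph m)) (graph_aut (word_graph n)).
Proof.
move=> mn.
pose children (u : seq 'I_m) := [seq i :: u | i <- enum 'I_m].
have cU u : uniq (children u) by rewrite map_inj_uniq ?enum_uniq // => i j [].
apply: (@unfolded_action_embeds n (graph_aut (word_graph m)) (seq 'I_m)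
    (fun g => g) children [::]) => //.
- by move=> u; rewrite size_map size_enum_ord.
- move=> g u _ /mapP[i _ ->]; rewrite word_aut_cons.
  by rewrite map_f // mem_enum.
- exact: word_aut_nil.
move=> g h gh; apply: graph_aut_eq => u; apply: gh.
elim: u => [|i u IHu]; first exact: descendant_root.
by apply: descendant_child IHu _; rewrite map_f // mem_enum.
Qed.

(** * Partitions of four points into pairs, and degree 4 inside degree 3 *)

Definition pairings : {set {set {set 'I_4}}} :=
  [set [set X; ~: X] | X : {set 'I_4} & #|X| == 2].

(** A pairing is determined by the partner of [ord0], which leaves three choices. *)
Lemma card_pairings : #|pairings| <= 3.
Proof.
pose F (i : 'I_3) : {set {set 'I_4}} :=
  let X := [set ord0; lift ord0 i] in [set X; ~: X].
rewrite -[leqRHS](card_ord 3); apply: leq_trans (leq_imset_card F 'I_3).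
apply/subset_leq_card/subsetP => _ /imsetP[X + ->]; rewrite inE => cX.
(* [X] and its complement give the same pairing. *)
wlog X0 : X cX / ord0 \in X => [IH|].
  have [|X0] := boolP (ord0 \in X); first exact: IH.
  rewrite setUC -{2}[X]setCK; apply: IH; last by rewrite inE.
  by rewrite -(eqn_add2l #|X|) cardsC (eqP cX) card_ord.
have [y X0y y0] : exists2 y, X = [set ord0; y] & ord0 != y.
  case/cards2P: cX X0 => x [y [xy ->]]; rewrite !inE => /orP[] /eqP ->.
    by exists y.
  by exists x; rewrite 1?setUC // eq_sym.
by case: (unliftP ord0 y) y0 X0y => [i ->|->] // _ ->; apply: imset_f.
Qed.

(** Injectivity gives the inclusion, and equal cardinalities do the rest. *)
Lemma imset_injC (T : finType) (f : T -> T) (X : {set T}) :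
  injective f -> f @: (~: X) = ~: (f @: X).
Proof.
move=> f_inj; apply/eqP; rewrite eqEcard; apply/andP; split.
  apply/subsetP => _ /imsetP[x xX ->]; rewrite inE mem_imset //.
  by rewrite inE in xX.
by rewrite card_imset // -(leq_add2l #|f @: X|) cardsC {1}card_imset // cardsC.
Qed.

Lemma pairings_imset (f : 'I_4 -> 'I_4) (P : {set {set 'I_4}}) : injective f ->
  P \in pairings -> (fun X : {set _} => f @: X) @: P \in pairings.
Proof.
move=> f_inj /imsetP[X]; rewrite inE => cX ->.
rewrite imsetU1 imset_set1 imset_injC //.
by apply/imsetP; exists (f @: X); rewrite // inE card_imset.
Qed.

(* Three levels of branching 3, 2 and 2 lie between a vertex [u] and its four
   children: [(u, None)] is [u] itself, [(u, Some (inl P))] a pairing [P] of the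
   children of [u], [(u, Some (inr X))] a block [X] of such a pairing. *)
Definition refined_node : eqType :=
  (seq 'I_4 * option ({set {set 'I_4}} + {set 'I_4}))%type.

Definition refined_act (g : graph_aut (word_graph 4)) (v : refined_node) :
    refined_node :=
  let f := word_aut_label g v.1 in
  (g v.1, match v.2 with
          | None => None
          | Some (inl P) => Some (inl ((fun X : {set _} => f @: X) @: P))
          | Some (inr X) => Some (inr (f @: X))
          end).

(* The size tests only discard nodes that are not reachable from the root. *)
Definition refined_children (v : refined_node) : seq refined_node :=
  match v.2 with
  | None => [seq (v.1, Some (inl P)) | P <- enum pairings]
  | Some (inl P) => if #|P| <= 3 then [seq (v.1, Some (inr X)) | X <- enum P] else [::]
  | Some (inr X) => if #|X| <= 3 then [seq (i :: v.1, None) | i <- enum X] else [::]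
  end.

Lemma word_aut4_embeds3 :
  embeds (graph_aut (word_graph 4)) (graph_aut (word_graph 3)).
Proof.
apply: (@unfolded_action_embeds 3 _ refined_node refined_act refined_children
          ([::], None)).
- case=> u [[P|X]|] //; rewrite /refined_act /= word_aut_label1; last by rewrite imset_id.
  by rewrite (eq_imset _ (@imset_id _)) imset_id.
- move=> g h [u [[P|X]|]] //; rewrite /refined_act /= word_aut_labelM.
    rewrite -imset_comp; congr (_, Some (inl _)).
    by apply: eq_imset => X /=; rewrite imset_comp.
  by rewrite imset_comp.
- case=> u [[P|X]|] /=; rewrite /refined_children /=; try case: ifP => // _;
    by rewrite map_inj_uniq ?enum_uniq // => ? ? [].
- case=> u [[P|X]|] /=; rewrite /refined_children /=; try case: ifP => // ?;
    by rewrite size_map -cardE ?card_pairings.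
- move=> g [u [[P|X]|]] x; rewrite /refined_children /=.
  (* Taking images does not increase cardinality, so the image passes the size test too. *)
  + case: ifP => // P3 /mapP[X XP ->]; rewrite (leq_trans (leq_imset_card _ _)) //.
    rewrite /refined_act /= (map_f (fun X => (g u, Some (inr X)))) //.
    by rewrite mem_enum imset_f // -mem_enum.
  + case: ifP => // X3 /mapP[i iX ->]; rewrite (leq_trans (leq_imset_card _ _)) //.
    rewrite /refined_act /= word_aut_cons.
    apply: (map_f (fun j => (j :: g u, None) : refined_node)).
    by rewrite mem_enum imset_f // -mem_enum.
  + move=> /mapP[P PP ->].
    apply: (map_f (fun Q => (g u, Some (inl Q)) : refined_node)).
    rewrite !mem_enum in PP *; apply: pairings_imset => //; exact: word_aut_label_inj.
- by move=> g; rewrite /refined_act /= word_aut_nil.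
move=> g h gh; apply: graph_aut_eq => u.
(* The action on [(u, None)] shows [g u], so faithfulness reduces to every vertex node being
   reachable. *)
suff /gh [] : descendant refined_children ([::], None) (u, None) by [].
elim: u => [|i u IHu]; first exact: descendant_root.
(* Any two-element block containing [i] leads to the child [i]; [lift i ord0] is just some point
   other than [i]. *)
pose X := [set i; lift i ord0]; pose P := [set X; ~: X].
have cX : #|X| = 2 by rewrite cards2 neq_lift.
have du : descendant refined_children ([::], None) (u, Some (inl P)).
  apply: descendant_child IHu _; rewrite map_f // mem_enum.
  by apply: (imset_f (fun Y : {set 'I_4} => [set Y; ~: Y])); rewrite inE cX.
have dP : descendant refined_children ([::], None) (u, Some (inr X)).
  apply: descendant_child du _; rewrite /refined_children /= cards2.
  (* The size is one plus a boolean, hence at most 3 without deciding whether the two blocks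
     differ. *)
  rewrite ifT ?(leq_ltn_trans (leq_b1 _)) //.
  apply: (map_f (fun Y => (u, Some (inr Y)) : refined_node)).
  by rewrite mem_enum set21.
apply: descendant_child dP _; rewrite /refined_children /= cX.
apply: (map_f (fun j => (j :: u, None) : refined_node)).
by rewrite mem_enum set21.
Qed.

(** * Transfer to arbitrary regular rooted trees *)

Lemma regular_Aut_embeds (m n : nat) (S T : rooted_tree) :
    regular_rooted m S -> regular_rooted n T ->
    embeds (graph_aut (word_graph m)) (graph_aut (word_graph n)) ->
  isomorphic_to_subgroup (Aut S) (Aut T).
Proof.
move=> /regular_rooted_labelling[phi [psi [phiK psiK phi_adj _]]].
move=> /regular_rooted_labelling[chi [omega [chiK omegaK chi_adj _]]] mn.
have psi_adj : {mono psi : x y / adj x y} by move=> x y; rewrite -phi_adj !psiK.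
apply/embeds_isomorphic/(embeds_trans (graph_iso_embeds psiK phiK psi_adj)).
exact/(embeds_trans mn)/(graph_iso_embeds chiK omegaK chi_adj).
Qed.

Theorem theorem3p8 (R3 R4 : rooted_tree)
    (R3_regular : regular_rooted 3 R3) (R4_regular : regular_rooted 4 R4) :
  isomorphic_to_subgroup (Aut R3) (Aut R4) /\
  isomorphic_to_subgroup (Aut R4) (Aut R3).
Proof.
split.
  exact: regular_Aut_embeds R3_regular R4_regular (word_aut_embeds_leq (leqnSn 3)).
exact: regular_Aut_embeds R4_regular R3_regular word_aut4_embeds3.
Qed.
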